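(* Let $(M,\varphi_i,\xi_i,\eta_i,g)$, $i=1,2,3$, be an almost $3$-contact metric manifold. If $M$ admits $\varphi_i$-compatible connections for every $i=1,2,3$, then $M$ admits $\varphi$-compatible connections for every almost contact metric structure $\varphi$ in the associated sphere $\Sigma_M$.
   Context: An almost contact metric structure $(\varphi,\xi,\eta,g)$ consists of a $(1,1)$-tensor field $\varphi$, a vector field $\xi$, a $1$-form $\eta$ and a Riemannian metric $g$ with $\varphi^2=-I+\eta\otimes\xi$, $\eta(\xi)=1$, $g(\varphi X,\varphi Y)=g(X,Y)-\eta(X)\eta(Y)$. An almost $3$-contact metric manifold $(M,\varphi_i,\xi_i,\eta_i,g)$, $i=1,2,3$, is a manifold of dimension $4n+3$ with three almost contact metric structures with the same $g$ such that, for every even permutation $(i,j,k)$ of $(1,2,3)$, $\varphi_k=\varphi_i\varphi_j-\eta_j\otimes\xi_i=-\varphi_j\varphi_i+\eta_i\otimes\xi_j$, $\xi_k=\varphi_i\xi_j=-\varphi_j\xi_i$, $\eta_k=\eta_i\circ\varphi_j=-\eta_j\circ\varphi_i$. Set $\mathcal H=\bigcap_i\ker\eta_i$, $\mathcal V=\langle\xi_1,\xi_2,\xi_3\rangle$, so $TM=\mathcal H\oplus\mathcal V$. The associated sphere $\Sigma_M$ consists of all almost contact metric structures $\varphi_a=\sum a_i\varphi_i$, $\xi_a=\sum a_i\xi_i$, $\eta_a=\sum a_i\eta_i$ with $a\in S^2\subset\mathbb R^3$ (and metric $g$). A metric connection $\nabla$ has skew torsion if $g(T(X,Y),Z)$ is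 a $3$-form. For $\varphi\in\Sigma_M$, a $\varphi$-compatible connection is a metric connection with skew torsion that preserves the splitting $TM=\mathcal H\oplus\mathcal V$ and satisfies $(\nabla_X\varphi)Y=0$ for all $X,Y\in\Gamma(\mathcal H)$. (Different structures $\varphi$ may have different compatible connections.) *)

(* Defs.v *)
From HB Require Import structures.
From mathcomp Require Import all_boot all_order all_algebra perm.
From mathcomp Require Import all_classical all_reals.
From mathcomp Require Import topology normedtype derive.

Set Implicit Arguments.
Unset Strict Implicit.
Unset Printing Implicit Defensive.

Import Order.TTheory GRing.Theory Num.Theory.
Import numFieldNormedType.Exports.

Local Open Scope classical_set_scope.
Local Open Scope ring_scope.

(** * Smooth maps between normed spaces *)

(* Meaningful for U open.  Continuity of f is recorded at every order; in
   finite dimension (the only use below) it follows from the other clauses as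
   soon as 0 < k. *)
Fixpoint Ck (R : realType) (V W : normedModType R) (k : nat) (U : set V)
    (f : V -> W) : Prop :=
  (forall x, U x -> {for x, continuous f}) /\
  (if k is k'.+1 then
     (forall x v, U x -> derivable f x v) /\ (forall v, Ck k' U ('D_v f))
   else True).

Definition smooth_on (R : realType) (V W : normedModType R) (U : set V)
    (f : V -> W) : Prop := forall k, Ck k U f.

Section CkTheory.
Variables (R : realType) (V : normedModType R).

Lemma Ck_eq (W : normedModType R) k (U : set V) (f g : V -> W) :
  open U -> (forall x, U x -> f x = g x) -> Ck k U f -> Ck k U g.
Proof.
move=> oU; elim: k f g => [|k IH] f g fg /= [cf df].
all: have nfg x : U x -> {near x, f =1 g}
  by move=> Ux; apply: filterS (open_nbhs_nbhs (conj oU Ux)) => y; exact: fg.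
all: have cg x : U x -> {for x, continuous g}
  by move=> Ux; rewrite /prop_for /continuous_at -(fg x Ux);
     apply: cvg_trans (cf x Ux); exact: near_eq_cvg (nfg x Ux).
  by split.
split=> //; case: df => df Df; split.
  by move=> x v Ux; apply: near_eq_derivable (df x v Ux); exact: nfg.
by move=> v; apply: IH (Df v) => x Ux; apply: near_eq_derive; exact: nfg.
Qed.

Lemma Ck_pred (W : normedModType R) k (U : set V) (f : V -> W) :
  Ck k.+1 U f -> Ck k U f.
Proof.
by elim: k f => [|k IH] f /= [cf [df Df]] //; split=> //; split=> // v; apply: IH (Df v).
Qed.

Lemma Ck_cst (W : normedModType R) k (U : set V) (c : W) : Ck k U (cst c : V -> W).
Proof.
elim: k c => [|k IH] c /=; (split; first by move=> x _; exact: cst_continuous) => //.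
split=> [x v _|v]; first exact: derivable_cst.
have -> : 'D_v (cst c : V -> W) = cst 0 by apply/funext => x; rewrite derive_cst.
exact: IH.
Qed.

Lemma CkD (W : normedModType R) k (U : set V) (f g : V -> W) : open U ->
  Ck k U f -> Ck k U g -> Ck k U (f + g).
Proof.
move=> oU; elim: k f g => [|k IH] f g /= [cf df] [cg dg].
  by split=> // x Ux; apply: continuousD; [exact: cf|exact: cg].
split=> [x Ux|]; first by apply: continuousD; [exact: cf|exact: cg].
case: df dg => df Df [dg Dg]; split=> [x v Ux|v].
  by apply: derivableD; [exact: df|exact: dg].
apply: Ck_eq (IH _ _ (Df v) (Dg v)) => // x Ux.
by rewrite deriveD //; [exact: df|exact: dg].
Qed.

Lemma CkM k (U : set V) (f g : V -> R) : open U ->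
  Ck k U (f : V -> R^o) -> Ck k U (g : V -> R^o) ->
  Ck k U (f * g : V -> R^o).
Proof.
move=> oU; elim: k f g => [|k IH] f g /= [cf df] [cg dg].
  by split=> // x Ux; apply: continuousM; [exact: cf|exact: cg].
split=> [x Ux|]; first by apply: continuousM; [exact: cf|exact: cg].
case: (df) (dg) => df' Df [dg' Dg]; split=> [x v Ux|v].
  by apply: derivableM; [exact: df'|exact: dg'].
have pf : Ck k U (f : V -> R^o) by apply: Ck_pred; split.
have pg : Ck k U (g : V -> R^o) by apply: Ck_pred; split.
apply: Ck_eq (CkD oU (IH _ _ pf (Dg v)) (IH _ _ pg (Df v))) => // x Ux.
by rewrite deriveM //; [exact: df'|exact: dg'].
Qed.

End CkTheory.

(** * Smooth manifolds *)

Record chart (R : realType) (m : nat) (T : topologicalType) := Chart {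
  chart_dom : set T;
  chart_map : T -> 'rV[R]_m;
  chart_inv : 'rV[R]_m -> T;
  chart_dom_open : open chart_dom;
  chart_img_open : open (chart_map @` chart_dom);
  chart_mapK : forall x, chart_dom x -> chart_inv (chart_map x) = x;
  chart_map_cts : forall x, chart_dom x -> {for x, continuous chart_map};
  chart_inv_cts : forall y, (chart_map @` chart_dom) y ->
    {for y, continuous chart_inv} }.

Record smooth_manifold (R : realType) (m : nat) := SmoothManifold {
  mpoint :> topologicalType;
  mfd_hausdorff : hausdorff_space mpoint;
  mfd_second_countable : @second_countable mpoint;
  atlas : set (chart R m mpoint);
  atlas_cover : forall x, exists2 c, atlas c & chart_dom c x;
  atlas_smooth : forall c d, atlas c -> atlas d ->
    smooth_on (chart_map c @` (chart_dom c `&` chart_dom d))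
              (chart_map d \o chart_inv c) }.

Section SmoothFunctions.
Variables (R : realType) (m : nat) (M : smooth_manifold R m).

Definition is_smooth (f : M -> R) : Prop := forall c, atlas c ->
  smooth_on (chart_map c @` chart_dom c) (f \o chart_inv c : 'rV[R]_m -> R^o).

Definition smooth_pred : {pred M -> R} := [pred f | `[< is_smooth f >]].

(* C^oo(M) *)
Record sfun := SFun { sfun_fun :> M -> R; sfun_smooth : sfun_fun \in smooth_pred }.

HB.instance Definition _ := [isSub for sfun_fun].
HB.instance Definition _ := [Choice of sfun by <:].

Lemma smooth_cst (a : R) : cst a \in smooth_pred.
Proof. by apply/asboolP => c _ k; exact: Ck_cst. Qed.

Lemma smooth_subring : subring_closed smooth_pred.
Proof.
have sM f g : f \in smooth_pred -> g \in smooth_pred -> f * g \in smooth_pred.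
  move=> /asboolP sf /asboolP sg; apply/asboolP => c ac k.
  have h := CkM (@chart_img_open _ _ _ c) (sf c ac k) (sg c ac k).
  exact: h.
split=> [||//]; first exact: smooth_cst.
move=> f g sf sg; have -> : f - g = f + cst (- 1) * g.
  by apply/funext => x; rewrite /= /GRing.add /GRing.mul /= mulN1r.
move: (sf) (sM _ _ (smooth_cst (- 1)) sg) => /asboolP sf' /asboolP sg'.
apply/asboolP => c ac k.
exact: (CkD (@chart_img_open _ _ _ c) (sf' c ac k) (sg' c ac k)).
Qed.

HB.instance Definition _ :=
  GRing.SubChoice_isSubComPzRing.Build (M -> R) smooth_pred sfun smooth_subring.

Definition scst (a : R) : sfun := SFun (smooth_cst a).

End SmoothFunctions.

(** * Vector fields *)

(* Smooth vector fields are the R-linear derivations of C^oo(M) and (p, q)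
   tensor fields are C^oo(M)-multilinear maps on vector fields. *)
Section VectorFields.
Variables (R : realType) (m : nat) (M : smooth_manifold R m).

Record vfield := VField {
  vf_fun :> sfun M -> sfun M;
  vf_add : {morph vf_fun : f g / f + g};
  vf_scale : forall (a : R) f, vf_fun (scst M a * f) = scst M a * vf_fun f;
  vf_leibniz : forall f g, vf_fun (f * g) = f * vf_fun g + g * vf_fun f }.

HB.instance Definition _ := gen_eqMixin vfield.
HB.instance Definition _ := gen_choiceMixin vfield.

Lemma vf_ext (X Y : vfield) : (forall f, X f = Y f) -> X = Y.
Proof.
case: X Y => [X a b c] [Y a' b' c'] /= /funext XY; subst Y.
by congr VField; exact: Prop_irrelevance.
Qed.

Program Definition vf0 : vfield := @VField (fun=> 0) _ _ _.
Next Obligation. by move=> f g /=; rewrite addr0. Qed.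
Next Obligation. by move=> a f /=; rewrite mulr0. Qed.
Next Obligation. by move=> f g /=; rewrite !mulr0 addr0. Qed.

Program Definition vfD (X Y : vfield) : vfield :=
  @VField (fun f => X f + Y f) _ _ _.
Next Obligation. by move=> X Y f g /=; rewrite !vf_add addrACA. Qed.
Next Obligation. by move=> X Y a f /=; rewrite !vf_scale mulrDr. Qed.
Next Obligation.
by move=> X Y f g /=; rewrite !vf_leibniz !mulrDr addrACA.
Qed.

Program Definition vfN (X : vfield) : vfield := @VField (fun f => - X f) _ _ _.
Next Obligation. by move=> X f g /=; rewrite vf_add opprD. Qed.
Next Obligation. by move=> X a f /=; rewrite vf_scale mulrN. Qed.
Next Obligation. by move=> X f g /=; rewrite vf_leibniz opprD !mulrN. Qed.

Program Definition vfZ (h : sfun M) (X : vfield) : vfield :=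
  @VField (fun f => h * X f) _ _ _.
Next Obligation. by move=> h X f g /=; rewrite vf_add mulrDr. Qed.
Next Obligation. by move=> h X a f /=; rewrite vf_scale mulrCA. Qed.
Next Obligation.
by move=> h X f g /=; rewrite vf_leibniz mulrDr !(mulrCA h).
Qed.

Lemma vfDA : associative vfD.
Proof. by move=> X Y Z; apply: vf_ext => f /=; rewrite addrA. Qed.
Lemma vfDC : commutative vfD.
Proof. by move=> X Y; apply: vf_ext => f /=; rewrite addrC. Qed.
Lemma vf0D : left_id vf0 vfD.
Proof. by move=> X; apply: vf_ext => f /=; rewrite add0r. Qed.
Lemma vfND : left_inverse vf0 vfN vfD.
Proof. by move=> X; apply: vf_ext => f /=; rewrite addNr. Qed.

HB.instance Definition _ := GRing.isZmodule.Build vfield vfDA vfDC vf0D vfND.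

Lemma vfZA a b X : vfZ a (vfZ b X) = vfZ (a * b) X.
Proof. by apply: vf_ext => f /=; rewrite mulrA. Qed.
Lemma vf1Z : left_id 1 vfZ.
Proof. by move=> X; apply: vf_ext => f /=; rewrite mul1r. Qed.
Lemma vfZDr : right_distributive vfZ +%R.
Proof. by move=> a X Y; apply: vf_ext => f /=; rewrite mulrDr. Qed.
Lemma vfZDl X : {morph vfZ^~ X : a b / a + b}.
Proof. by move=> a b; apply: vf_ext => f /=; rewrite mulrDl. Qed.

HB.instance Definition _ :=
  GRing.Zmodule_isLmodule.Build (sfun M) vfield vfZA vf1Z vfZDr vfZDl.

Program Definition lie (X Y : vfield) : vfield :=
  @VField (fun f => X (Y f) - Y (X f)) _ _ _.
Next Obligation. by move=> X Y f g /=; rewrite !vf_add opprD addrACA. Qed.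
Next Obligation. by move=> X Y a f /=; rewrite !vf_scale mulrBr. Qed.
Next Obligation.
move=> X Y f g /=; rewrite !(vf_add, vf_leibniz) !mulrBr opprD.
rewrite (mulrC (Y g)) (mulrC (X g)) (mulrC (Y f) (X g)) (mulrC (X f) (Y g)).
set a := f * X _; set b := g * X _; set c := f * Y _; set d := g * Y _.
set p := Y g * _; set q := X g * _.
rewrite -opprD (addrACA a p) (addrACA c q) (addrC q p) opprD (addrACA (a + b)) subrr.
by rewrite addr0 opprD addrACA.
Qed.

End VectorFields.

(** * Riemannian metrics and connections *)

Section Riemannian.
Variables (R : realType) (m : nat) (M : smooth_manifold R m).
Local Notation VF := (vfield M).
Local Notation Cinf := (sfun M).

(* The tangent vector of X at p is nonzero iff X f p != 0 for some f. *)
Record riem_metric := RiemMetric {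
  metric :> VF -> VF -> Cinf;
  metric_sym : forall X Y, metric X Y = metric Y X;
  metric_lin : forall Y, scalar (fun X => metric X Y);
  metric_posdef : forall (X : VF) (p : M),
    (exists f : Cinf, X f p != 0) -> 0 < metric X X p }.

Record connection := Connection {
  nabla :> VF -> VF -> VF;
  nabla_lin : forall Y, linear (fun X => nabla X Y);
  nabla_add : forall X, {morph nabla X : Y Z / Y + Z};
  nabla_leibniz : forall X (f : Cinf) Y,
    nabla X (f *: Y) = X f *: Y + f *: nabla X Y }.

Definition torsion (D : connection) (X Y : VF) : VF := D X Y - D Y X - lie X Y.

Definition three_form (w : VF -> VF -> VF -> Cinf) : Prop :=
  [/\ forall Y Z, scalar (fun X => w X Y Z),
      forall X Z, scalar (fun Y => w X Y Z),
      forall X Y, scalar (fun Z => w X Y Z) &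
      forall X Y, [/\ w X X Y = 0, w X Y X = 0 & w X Y Y = 0]].

Variable g : riem_metric.

Definition metric_connection (D : connection) : Prop :=
  forall X Y Z : VF, X (g Y Z) = g (D X Y) Z + g Y (D X Z).

Definition skew_torsion (D : connection) : Prop :=
  three_form (fun X Y Z => g (torsion D X Y) Z).

(** * Almost contact metric and almost 3-contact metric structures *)

Record contact_tensors := ContactTensors {
  phi : {linear VF -> VF};
  xi : VF;
  eta : {scalar VF} }.

Record almost_contact_metric := AlmostContactMetric {
  acm_tensors :> contact_tensors;
  acm_phi2 : forall X : VF,
    phi acm_tensors (phi acm_tensors X) =
      - X + eta acm_tensors X *: xi acm_tensors;
  acm_eta_xi : eta acm_tensors (xi acm_tensors) = 1;
  acm_metric : forall X Y : VF,
    g (phi acm_tensors X) (phi acm_tensors Y) =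
      g X Y - eta acm_tensors X * eta acm_tensors Y }.

(* The indices 1, 2, 3 are the elements 0, 1, 2 of 'I_3. *)
Definition even_permutation (i j k : 'I_3) : Prop :=
  exists2 s : {perm 'I_3}, ~~ odd_perm s & [/\ s 0 = i, s 1 = j & s 2 = k].

Record almost_3contact_metric := Almost3ContactMetric {
  a3_str :> 'I_3 -> almost_contact_metric;
  a3_phi : forall i j k, even_permutation i j k -> forall X : VF,
    phi (a3_str k) X =
      phi (a3_str i) (phi (a3_str j) X) - eta (a3_str j) X *: xi (a3_str i) /\
    phi (a3_str k) X =
      - phi (a3_str j) (phi (a3_str i) X) + eta (a3_str i) X *: xi (a3_str j);
  a3_xi : forall i j k, even_permutation i j k ->
    xi (a3_str k) = phi (a3_str i) (xi (a3_str j)) /\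
    xi (a3_str k) = - phi (a3_str j) (xi (a3_str i));
  a3_eta : forall i j k, even_permutation i j k -> forall X : VF,
    eta (a3_str k) X = eta (a3_str i) (phi (a3_str j) X) /\
    eta (a3_str k) X = - eta (a3_str j) (phi (a3_str i) X) }.

Section Combination.
Variables (a : 'I_3 -> R) (T : 'I_3 -> contact_tensors).

Definition comb_phi (X : VF) : VF := \sum_i scst M (a i) *: phi (T i) X.
Definition comb_xi : VF := \sum_i scst M (a i) *: xi (T i).
Definition comb_eta (X : VF) : Cinf := \sum_i scst M (a i) * eta (T i) X.

Lemma comb_phi_linear : linear comb_phi.
Proof.
move=> f X Y; rewrite /comb_phi scaler_sumr -big_split; apply: eq_bigr => i _.
by rewrite linearP scalerDr !scalerA mulrC.
Qed.

Lemma comb_eta_scalar : scalar comb_eta.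
Proof.
move=> f X Y; rewrite /comb_eta mulr_sumr -big_split; apply: eq_bigr => i _.
by rewrite linearP /= mulrDr mulrCA.
Qed.

HB.instance Definition _ :=
  GRing.isLinear.Build Cinf VF VF *:%R comb_phi comb_phi_linear.
HB.instance Definition _ :=
  GRing.isLinear.Build Cinf VF Cinf *%R comb_eta comb_eta_scalar.

Definition comb_tensors : contact_tensors :=
  ContactTensors comb_phi comb_xi comb_eta.

End Combination.

Variable S : almost_3contact_metric.

(* Sections of H and of V; the xi_i form a global frame of V. *)
Definition horizontal : set VF := [set X | forall i : 'I_3, eta (S i) X = 0].
Definition vertical : set VF :=
  [set X | exists f : 'I_3 -> Cinf, X = \sum_i f i *: xi (S i)].

(* For a in S^2 the combination is automatically an almost contact metric
   structure for g, so no condition beyond a in S^2 is imposed. *)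
Definition associated_sphere : set contact_tensors :=
  [set comb_tensors a (fun i => S i) | a in [set a : 'I_3 -> R | \sum_i a i ^+ 2 = 1]].

Definition preserves_splitting (D : connection) : Prop :=
  (forall X Y, horizontal Y -> horizontal (D X Y)) /\
  (forall X Y, vertical Y -> vertical (D X Y)).

Definition nabla_phi (D : connection) (A : contact_tensors) (X Y : VF) : VF :=
  D X (phi A Y) - phi A (D X Y).

Definition compatible (A : contact_tensors) (D : connection) : Prop :=
  [/\ metric_connection D, skew_torsion D, preserves_splitting D &
      forall X Y, horizontal X -> horizontal Y -> nabla_phi D A X Y = 0].

End Riemannian.

(* Main.v *)
(* Let D_i be compatible with phi_i.  The difference of two metric connections with
   skew torsion is a 3-form, so on H the tensors B_i = D_0 phi_i are the commutators of
   phi_i with the 3-forms D_i - D_0; moreover B_0 = 0 and B_2 = phi_0 B_1.  That B_i comes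
   from a 3-form forces B_i (phi_i X) (phi_i X) = B_i X X, so the quadratic map
   X |-> B_1 X X on H is invariant under phi_1 and phi_2, hence under phi_0 and under
   every phi_a with a in S^2.  Thus B_a = sum_i a_i B_i satisfies the same identity for phi_a,
   which is exactly the condition for D_0 to be corrected by a horizontal 3-form
   to a connection making phi_a parallel along H. *)
Require Import Defs.
From mathcomp Require Import all_boot all_order all_algebra perm.
From mathcomp Require Import all_classical all_reals.
From mathcomp Require Import topology normedtype derive.
From mathcomp Require Import ring.

Set Implicit Arguments.
Unset Strict Implicit.
Unset Printing Implicit Defensive.

Import Order.TTheory GRing.Theory Num.Theory.

Local Open Scope classical_set_scope.
Local Open Scope ring_scope.

(** Derives one equation from another: it remains to compare the differences of the two sides, which
    [ring] can do. *)
Lemma eq_of_sub (V : zmodType) (x y u v : V) : x = y -> u - v = x - y -> u = v.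
Proof. by move=> ->; rewrite subrr => /eqP; rewrite subr_eq0 => /eqP. Qed.

(** * Symmetric bilinear forms and the skew correction *)

Section BilinearForm.
Variables (A : comPzRingType) (V : lmodType A) (g : V -> V -> A).
Hypotheses (gC : forall X Y, g X Y = g Y X)
           (g_scalar : forall Y, scalar (g^~ Y)).

Lemma sformDl X Y Z : g (X + Y) Z = g X Z + g Y Z.
Proof. by have := g_scalar Z 1 X Y; rewrite scale1r mul1r. Qed.

Lemma sform0l Z : g 0 Z = 0.
Proof. by apply: (addrI (g 0 Z)); rewrite -sformDl !addr0. Qed.

Lemma sformNl X Z : g (- X) Z = - g X Z.
Proof. by apply/eqP; rewrite -addr_eq0 -sformDl addNr sform0l. Qed.

Lemma sformBl X Y Z : g (X - Y) Z = g X Z - g Y Z.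
Proof. by rewrite sformDl sformNl. Qed.

Lemma sformZl a X Z : g (a *: X) Z = a * g X Z.
Proof. by have := g_scalar Z a X 0; rewrite addr0 sform0l addr0. Qed.

Lemma sform_suml n (F : 'I_n -> V) Z : g (\sum_i F i) Z = \sum_i g (F i) Z.
Proof.
by elim/big_ind2: _ => [|X a Y b <- <-|]; rewrite ?sform0l ?sformDl.
Qed.

Lemma sformDr X Y Z : g Z (X + Y) = g Z X + g Z Y.
Proof. by rewrite gC sformDl !(gC _ Z). Qed.

Lemma sform0r Z : g Z 0 = 0.
Proof. by rewrite gC sform0l. Qed.

Lemma sformNr X Z : g Z (- X) = - g Z X.
Proof. by rewrite gC sformNl gC. Qed.

Lemma sformZr a X Z : g Z (a *: X) = a * g Z X.
Proof. by rewrite gC sformZl gC. Qed.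

Lemma sform_sumr n (F : 'I_n -> V) Z : g Z (\sum_i F i) = \sum_i g Z (F i).
Proof. by rewrite gC sform_suml; apply: eq_bigr => i _; rewrite gC. Qed.

Definition sformE :=
  (sformDl, sformDr, sformNl, sformNr, sformZl, sformZr, sform0l, sform0r).

Variable half : A.
Hypothesis halfE : half + half = 1.

Lemma half_eq0 (x : A) : x + x = 0 -> x = 0.
Proof. by move=> xx; rewrite -[x]mul1r -halfE mulrDl -mulrDr xx mulr0. Qed.

Lemma half_eq0v (X : V) : X + X = 0 -> X = 0.
Proof. by move=> XX; rewrite -[X]scale1r -halfE scalerDl -scalerDr XX scaler0. Qed.

(* If I is an almost Hermitian structure on H and B = nabla I for a metric
   connection nabla on H, the symmetry hypothesis on B X X expresses the vanishing of the
   Gray-Hervella component W_2 of B, and skew_correction is the unique 3-form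
   theta with (nabla + theta) I = 0; b is the transpose of B, which gives the
   middle term without raising an index. *)
Section SkewCorrection.
Variables (H : set V) (I : V -> V) (B b : V -> V -> V).
Hypotheses
  (H_linear : forall a X Y, H X -> H Y -> H (a *: X + Y))
  (I_linear : linear I)
  (HI : forall X, H X -> H (I X))
  (II : forall X, H X -> I (I X) = - X)
  (gI : forall X Y, H X -> H Y -> g (I X) Y = - g X (I Y))
  (B_linearl : forall Z, linear (B^~ Z))
  (B_linearr : forall Z, linear (B Z))
  (HB : forall X Y, H X -> H Y -> H (B X Y))
  (BI : forall X Y, H X -> H Y -> B X (I Y) = - I (B X Y))
  (gB : forall X Y Z, H X -> H Y -> H Z -> g (B X Y) Z = - g Y (B X Z))
  (Hb : forall X Y, H X -> H Y -> H (b X Y))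
  (B_diag : forall X, H X -> B (I X) (I X) = B X X)
  (gb : forall X Y Z, H X -> H Y -> H Z -> g (b X Y) Z = g (B Z X) Y).

Definition skew_correction X Y :=
  half *: (I (B Y X) + b (I X) Y - B (I X) Y).

Local Notation w X Y Z := (g (B X Y) Z).

Let HD X Y : H X -> H Y -> H (X + Y).
Proof. by move=> HX HY; rewrite -[X]scale1r; exact: H_linear. Qed.

Let HS a X : H X -> H (a *: X).
Proof. by move=> HX; rewrite -[a](subrK 1) scalerDl scale1r; exact: H_linear. Qed.

Let ID : {morph I : X Y / X + Y}.
Proof. by move=> X Y; have := I_linear 1 X Y; rewrite !scale1r. Qed.

Let BDl Z : {morph B^~ Z : X Y / X + Y}.
Proof. by move=> X Y; have := B_linearl Z 1 X Y; rewrite !scale1r. Qed.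

Let BDr Z : {morph B Z : X Y / X + Y}.
Proof. by move=> X Y; have := B_linearr Z 1 X Y; rewrite !scale1r. Qed.

Let wS X Y Z : H X -> H Y -> H Z -> w X Y Z = - w X Z Y.
Proof. by move=> HX HY HZ; rewrite gB // gC. Qed.

(** [I] slides between the last two slots, because the sign from [BI] and the sign from [gI]
    cancel. *)
Let wI X Y Z : H X -> H Y -> H Z -> w X (I Y) Z = w X Y (I Z).
Proof.
by move=> HX HY HZ; rewrite BI // sformNl gI ?opprK //; exact: HB.
Qed.

Let wII X Y Z : H X -> H Y -> H Z -> w X (I Y) (I Z) = - w X Y Z.
Proof. by move=> HX HY HZ; rewrite wI ?II ?sformNr //; exact: HI. Qed.

Let wNr X Y Z : w X (- Y) Z = - w X Y Z.
Proof.
have B0 : B X 0 = 0 by apply: (addrI (B X 0)); rewrite -BDr !addr0.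
by apply/eqP; rewrite -addr_eq0 -sformDl -BDr addNr B0 sform0l.
Qed.

Let w_diag X Z : H X -> H Z -> w (I X) X Z = - w X X (I Z).
Proof.
move=> HX HZ; have HIX := HI HX.
by rewrite -[B X X]B_diag // wII ?opprK.
Qed.

(** The polarization of [B_diag], read at [X + Y]. *)
Let w_polar X Y Z : H X -> H Y -> H Z ->
  w (I X) (I Y) Z + w (I Y) (I X) Z = w X Y Z + w Y X Z.
Proof.
move=> HX HY HZ.
have := congr1 (g^~ Z) (B_diag (HD HX HY)).
rewrite ID !(BDl, BDr) !sformDl !B_diag // => E.
by apply: (eq_of_sub E); ring.
Qed.

(** Passing to the trilinear form replaces the transpose [b] by values of [w], on which all
    symmetries can be checked. *)
Lemma form_skew_correction X Y Z : H X -> H Y -> H Z ->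
  g (skew_correction X Y) Z =
  half * (w Y (I Z) X + w Z (I X) Y - w (I X) Y Z).
Proof.
move=> HX HY HZ; have [HIX HIZ] := (HI HX, HI HZ).
rewrite sformZl sformBl sformDl gb // gI //; last exact: HB.
by rewrite (wS HY HIZ HX).
Qed.

Lemma H_skew_correction X Y : H X -> H Y -> H (skew_correction X Y).
Proof.
move=> HX HY; have HIX := HI HX.
apply: HS; apply: HD; last by rewrite -scaleN1r; apply: HS; exact: HB.
by apply: HD; [apply: HI; exact: HB|exact: Hb].
Qed.

(** [B_diag] enters here: by [w_diag] the outer terms cancel. The middle term [w Z (I X) X] equals
    its own negative, by skewness in the last two slots and by sliding [I]. *)
Lemma skew_correction_alt12 X Z : H X -> H Z -> g (skew_correction X X) Z = 0.
Proof.
move=> HX HZ; have [HIX HIZ] := (HI HX, HI HZ).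
rewrite form_skew_correction // w_diag // (wS HX HIZ HX).
have -> : w Z (I X) X = 0; last by ring.
by apply: half_eq0; rewrite {1}(wS HZ HIX HX) wI // addNr.
Qed.

Lemma skew_correction_alt23 X Y : H X -> H Y -> g (skew_correction X Y) Y = 0.
Proof.
move=> HX HY; have [HIX HIY] := (HI HX, HI HY).
rewrite form_skew_correction //.
have -> : w (I X) Y Y = 0.
  by apply: half_eq0; rewrite {1}(wS HIX HY HY) addNr.
by rewrite (wS HY HIX HY) -wI // addrN subr0 mulr0.
Qed.

(** Stated after pairing with [Z], since the linearity of [b] comes from that of its transpose
    [B]. *)
Lemma skew_correction_linearl a X Y U Z : H X -> H Y -> H U -> H Z ->
  g (skew_correction (a *: X + Y) U) Z =
  a * g (skew_correction X U) Z + g (skew_correction Y U) Z.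
Proof.
move=> HX HY HU HZ; have HXY := H_linear a HX HY.
rewrite !form_skew_correction // !I_linear !(B_linearl _, B_linearr _).
rewrite !sformE; ring.
Qed.

Lemma skew_correction_linearr a X Y U Z : H X -> H Y -> H U -> H Z ->
  g (skew_correction U (a *: X + Y)) Z =
  a * g (skew_correction U X) Z + g (skew_correction U Y) Z.
Proof.
move=> HX HY HU HZ; have HXY := H_linear a HX HY.
rewrite !form_skew_correction // !(B_linearl _, B_linearr _).
rewrite !sformE; ring.
Qed.

(** Paired with [Z], the expression is [w X Y Z] plus the values of the correction at (X, I Y, Z)
    and (X, Y, I Z). What remains is a combination of two instances of [w_polar]. *)
Lemma skew_correction_parallel X Y Z : H X -> H Y -> H Z ->
  g (B X Y + skew_correction X (I Y) - I (skew_correction X Y)) Z = 0.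
Proof.
move=> HX HY HZ; have [HIX HIY HIZ] := And3 (HI HX) (HI HY) (HI HZ).
rewrite sformBl sformDl gI //; last exact: H_skew_correction.
rewrite !form_skew_correction //.
rewrite (wII HZ HX HY) II // wNr opprK -(wI HIX HY HZ).
have := w_polar HX HY HZ; have := w_polar HZ HX HY.
rewrite (wS HIX HIZ HY) -(wI HIX HY HZ) (wS HIY HIX HZ) -(wI HIY HZ HX).
rewrite (wS HX HZ HY) (wS HY HX HZ) => E F.
(* This is half the difference of the polar identities for (Z, X, Y) and (X, Y, Z); the lone
   [w X Y Z] is then split into two halves to match. *)
apply: (eq_of_sub (congr1 ( *%R half) (f_equal2 +%R E (esym F)))).
rewrite -[w X Y Z in LHS]mul1r -halfE; ring.
Qed.

End SkewCorrection.
End BilinearForm.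

(** * Constant functions, constant coefficients and nondegeneracy of the metric *)

Section Constants.
Variables (R : realType) (m : nat) (M : smooth_manifold R m).

Lemma sfun_ext (f h : sfun M) : f =1 h -> f = h.
Proof. by move=> fh; apply: val_inj; exact: funext. Qed.

Lemma scst1 : scst M 1 = 1.
Proof. exact: sfun_ext. Qed.

Lemma scst_half : scst M 2^-1 + scst M 2^-1 = 1.
Proof.
apply: sfun_ext => p; change (2^-1 + 2^-1 = 1 :> R).
by rewrite [RHS]splitr div1r.
Qed.

Lemma scst_sum_sqr (a : 'I_3 -> R) :
  \sum_i scst M (a i) ^+ 2 = scst M (\sum_i a i ^+ 2).
Proof. by rewrite !big_ord_recl !big_ord0; apply: sfun_ext. Qed.

Lemma vfield_scst (X : vfield M) a : X (scst M a) = 0.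
Proof.
have X1 : X 1 = 0.
  have := vf_leibniz X 1 1; rewrite !mul1r => E.
  by apply: (addrI (X 1)); rewrite addr0 -E.
by rewrite -[scst M a]mulr1 vf_scale X1 mulr0.
Qed.

Lemma nabla_scst (D : connection M) X a Y :
  D X (scst M a *: Y) = scst M a *: D X Y.
Proof. by rewrite nabla_leibniz vfield_scst scale0r add0r. Qed.

Lemma nabla0r (D : connection M) X : D X 0 = 0.
Proof. by apply: (addrI (D X 0)); rewrite -nabla_add !addr0. Qed.

Lemma nablaNr (D : connection M) X Y : D X (- Y) = - D X Y.
Proof. by apply/eqP; rewrite -addr_eq0 -nabla_add addNr nabla0r. Qed.

Lemma nabla_sumr (D : connection M) X n (F : 'I_n -> vfield M) :
  D X (\sum_i F i) = \sum_i D X (F i).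
Proof. by elim/big_ind2: _ => [|U a V b <- <-|]; rewrite ?nabla0r ?nabla_add. Qed.

Variable g : riem_metric M.

Lemma metric_posdef0 W : g W W = 0 -> W = 0.
Proof.
move=> gWW; apply: vf_ext => f; apply: sfun_ext => p; apply/eqP/negPn/negP => Wfp.
have := @metric_posdef _ _ _ g W p (ex_intro _ f Wfp).
by rewrite gWW ltxx.
Qed.

Lemma metric_nondeg W : (forall Z, g W Z = 0) -> W = 0.
Proof. by move=> gW; exact: metric_posdef0. Qed.

(** Turns identities between vector fields into identities between functions, where [ring]
    applies. *)
Lemma metric_inj U W : (forall Z, g U Z = g W Z) -> U = W.
Proof.
move=> UW; apply/eqP; rewrite -subr_eq0; apply/eqP/metric_nondeg => Z.
by rewrite (sformBl (metric_lin g)) UW subrr.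
Qed.

End Constants.

(** * Almost contact and almost 3-contact structures *)

Section ContactTensors.
Variables (R : realType) (m : nat) (M : smooth_manifold R m) (g : riem_metric M).
Variable A : almost_contact_metric g.
Let gC := Defs.metric_sym g.
Let gE := sformE gC (metric_lin g).

(** From [phi (phi xi) = 0], applying [phi] once more gives [phi xi = c *: xi] with
    [c = eta (phi xi)]. Then [c *: (c *: xi) = 0], so [c * c = 0], hence [phi xi] has zero norm and
    positive definiteness concludes. *)
Lemma phi_xi : phi A (xi A) = 0.
Proof.
have E : eta A (phi A (xi A)) *: xi A = phi A (xi A).
  have := congr1 (phi A) (acm_phi2 A (xi A)).
  rewrite acm_phi2 linearD linearN linearZ /= acm_eta_xi scale1r addNr => /eqP.
  by rewrite addrC subr_eq0 => /eqP.
have c2 : eta A (phi A (xi A)) * eta A (phi A (xi A)) = 0.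
  have := acm_phi2 A (xi A).
  rewrite acm_eta_xi scale1r addNr -{1}E linearZ /= -E scalerA.
  move/(congr1 (eta A)); rewrite linearZ /= acm_eta_xi mulr1 linear0.
  by rewrite E.
apply: (metric_posdef0 (g := g)).
by rewrite -E !gE mulrA c2 mul0r.
Qed.

Lemma eta_metric X : eta A X = g X (xi A).
Proof.
have := acm_metric A X (xi A).
by rewrite phi_xi acm_eta_xi mulr1 !gE => /esym/eqP; rewrite subr_eq0 => /eqP.
Qed.

Lemma eta_phi X : eta A (phi A X) = 0.
Proof.
have := congr1 (phi A) (acm_phi2 A X).
rewrite acm_phi2 linearD linearN linearZ /= phi_xi scaler0 => /addrI E.
by have := congr1 (eta A) E; rewrite linearZ /= acm_eta_xi mulr1 linear0.
Qed.

Lemma metric_phi X Y : eta A X = 0 -> eta A Y = 0 -> g (phi A X) Y = - g X (phi A Y).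
Proof.
move=> X0 Y0; have := acm_metric A X (phi A Y).
by rewrite acm_phi2 X0 Y0 scale0r addr0 mul0r subr0 gE => <-; rewrite opprK.
Qed.

End ContactTensors.

Section ThreeContact.
Variables (R : realType) (m : nat) (M : smooth_manifold R m) (g : riem_metric M).
Variable S : almost_3contact_metric g.
Local Notation H := (horizontal S).
Let gC := Defs.metric_sym g.
Let gE := sformE gC (metric_lin g).
Local Notation halfE := (scst_half M).

Lemma even_permutation_012 : even_permutation 0 1 2.
Proof. by exists 1%g; [rewrite odd_perm1|rewrite !perm1]. Qed.

Lemma even_permutation_120 : even_permutation 1 2 0.
Proof.
pose s := tperm (0 : 'I_3) 1; pose t := tperm (0 : 'I_3) 2.
(* Products of permutations act from left to right, so [s * t] is the cycle 0 -> 1 -> 2 -> 0. *)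
exists (s * t)%g; first by rewrite odd_permM !odd_tperm.
by rewrite !permM; split; rewrite !permE.
Qed.

Lemma even_permutation_201 : even_permutation 2 0 1.
Proof.
pose s := tperm (0 : 'I_3) 1; pose t := tperm (0 : 'I_3) 2.
exists (t * s)%g; first by rewrite odd_permM !odd_tperm.
by rewrite !permM; split; rewrite !permE.
Qed.

Lemma ord3_cases (i : 'I_3) : [\/ i = 0, i = 1 | i = 2].
Proof.
by case: i => [[|[|[|]]]] // p; [constructor 1|constructor 2|constructor 3];
  exact: val_inj.
Qed.

(** The structure equations are indexed by even triples. This sorts a pair of distinct indices by
    cyclic orientation and supplies every rotation of the triple. *)
Lemma even_permutation_of_neq (i j : 'I_3) : i != j ->
  exists k,
    [/\ even_permutation i j k, even_permutation j k i & even_permutation k i j] \/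
    [/\ even_permutation j i k, even_permutation i k j & even_permutation k j i].
Proof.
have [e1 e2 e3] := And3 even_permutation_012 even_permutation_120 even_permutation_201.
case: (ord3_cases i) (ord3_cases j) => -> [] -> // _.
- by exists 2; left.
- by exists 1; right.
- by exists 2; right.
- by exists 0; left.
- by exists 1; left.
- by exists 0; right.
Qed.

Lemma horizontal_linear a X Y : H X -> H Y -> H (a *: X + Y).
Proof. by move=> HX HY i; rewrite linearP /= HX HY mulr0 addr0. Qed.

Lemma horizontalN X : H X -> H (- X).
Proof. by move=> HX i; rewrite linearN /= HX oppr0. Qed.

Lemma horizontalZ a X : H X -> H (a *: X).
Proof. by move=> HX i; rewrite linearZ /= HX mulr0. Qed.

Lemma horizontalB X Y : H X -> H Y -> H (X - Y).
Proof. by move=> HX HY i; rewrite linearB /= HX HY subr0. Qed.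

Lemma horizontalD X Y : H X -> H Y -> H (X + Y).
Proof. by move=> HX HY i; rewrite linearD /= HX HY addr0. Qed.

Lemma horizontal_sum n (F : 'I_n -> vfield M) : (forall i, H (F i)) -> H (\sum_i F i).
Proof. by move=> HF i; rewrite linear_sum big1 // => j _; exact: HF. Qed.

(** For [j] different from [i], [eta_j (phi_i X)] is [eta_k X] up to sign, with [k] the third
    index. *)
Lemma horizontal_phi i X : H X -> H (phi (S i) X).
Proof.
move=> HX j; have [->|ji] := eqVneq j i; first exact: eta_phi.
have [k [] [/(a3_eta S)/(_ X)[E E']]] := even_permutation_of_neq ji.
  by rewrite -E HX.
by rewrite -[LHS]opprK -E' HX oppr0.
Qed.

Lemma phi_phi i X : H X -> phi (S i) (phi (S i) X) = - X.
Proof. by move=> HX; rewrite acm_phi2 HX scale0r addr0. Qed.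

Lemma phi_cyc i j k X : even_permutation i j k -> H X ->
  phi (S i) (phi (S j) X) = phi (S k) X /\ phi (S j) (phi (S i) X) = - phi (S k) X.
Proof.
move=> /(a3_phi S)/(_ X)[E1 E2] HX; split; first by rewrite E1 HX scale0r subr0.
by rewrite E2 HX scale0r addr0 opprK.
Qed.

Lemma phi_anticomm i j X : i != j -> H X ->
  phi (S i) (phi (S j) X) = - phi (S j) (phi (S i) X).
Proof.
move=> ij HX; have [k [] [/phi_cyc/(_ HX)[-> ->]]] // := even_permutation_of_neq ij.
by rewrite opprK.
Qed.

(** Up to sign [xi_j = phi_i xi_k], which [eta_i] kills. *)
Lemma eta_xi_neq i j : i != j -> eta (S i) (xi (S j)) = 0.
Proof.
move=> ij; have [k [[_ _ e]|[_ e _]]] := even_permutation_of_neq ij.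
  by have [_ ->] := a3_xi S e; rewrite linearN /= eta_phi oppr0.
by have [-> _] := a3_xi S e; rewrite eta_phi.
Qed.

(** The orthogonal projection onto H, used to extend horizontal tensors by zero on V. *)
Definition horizontal_proj (X : vfield M) : vfield M :=
  X - \sum_i eta (S i) X *: xi (S i).
Local Notation h := horizontal_proj.

Lemma horizontal_proj_linear : linear h.
Proof.
move=> a X Y; rewrite /h scalerBr addrACA -opprD scaler_sumr -big_split /=.
by congr (_ - _); apply: eq_bigr => i _; rewrite linearP /= scalerDl scalerA.
Qed.

Lemma eta_vertical (f : 'I_3 -> sfun M) j : eta (S j) (\sum_i f i *: xi (S i)) = f j.
Proof.
rewrite linear_sum (bigD1 j) //= linearZ /= acm_eta_xi mulr1 big1 ?addr0 // => i ij.
by rewrite linearZ /= eta_xi_neq ?mulr0 // eq_sym.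
Qed.

Lemma horizontal_horizontal_proj X : H (h X).
Proof. by move=> j; rewrite linearB /= eta_vertical subrr. Qed.

Lemma horizontal_projE X : H X -> h X = X.
Proof. by move=> HX; rewrite /h big1 ?subr0 // => i _; rewrite HX scale0r. Qed.

Lemma horizontal_proj_vertical X : vertical S X -> h X = 0.
Proof.
move=> [f ->]; rewrite /h; apply/eqP; rewrite subr_eq0; apply/eqP.
by apply: eq_bigr => j _; rewrite eta_vertical.
Qed.

Lemma horizontal_proj_sym X Y : g (h X) Y = g X (h Y).
Proof.
rewrite !gE /= (sform_suml (metric_lin g)) (sform_sumr gC (metric_lin g)).
congr (_ - _); apply: eq_bigr => i _.
by rewrite !gE !eta_metric mulrC (gC Y).
Qed.

(** * The endomorphisms of the associated sphere on H *)

Section Sphere.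
Variable a : 'I_3 -> R.
Hypothesis a_sphere : \sum_i a i ^+ 2 = 1.
Local Notation I := (comb_phi a (fun i => S i)).
Local Notation c i := (scst M (a i)).

Lemma sphere_sqr : c 0 * c 0 + c 1 * c 1 + c 2 * c 2 = 1.
Proof.
have := scst_sum_sqr M a; rewrite a_sphere scst1 => <-.
rewrite !big_ord_recl big_ord0 addr0 addrA.
by do 2?[congr (_ + _)]; congr (_ * _); congr (scst M (a _)); exact: val_inj.
Qed.

Lemma comb_phiE X : I X = c 0 *: phi (S 0) X + c 1 *: phi (S 1) X + c 2 *: phi (S 2) X.
Proof.
rewrite /comb_phi !big_ord_recl big_ord0 addr0 addrA.
by do 2?[congr (_ + _)]; congr (_ *: _); do [congr (scst M (a _))|congr (phi (S _) X)];
  exact: val_inj.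
Qed.

Lemma horizontal_comb_phi X : H X -> H (I X).
Proof.
by move=> HX; apply: horizontal_sum => i; apply: horizontalZ; exact: horizontal_phi.
Qed.

Lemma metric_comb_phi X Y : H X -> H Y -> g (I X) Y = - g X (I Y).
Proof.
move=> HX HY; rewrite !comb_phiE !gE !(metric_phi (HX _) (HY _)); ring.
Qed.

(* B X X is a quadratic map on H invariant under phi_0, phi_1, phi_2; its polarization
   P satisfies P(Y, phi_i Y) = P(phi_i Y, - Y) = 0, hence P(phi_i X, phi_j X) = 0
   for i != j. *)
Lemma diag_comb_phi (B : vfield M -> vfield M -> vfield M) :
  (forall Z, linear (B^~ Z)) -> (forall Z, linear (B Z)) ->
  (forall i X, H X -> B (phi (S i) X) (phi (S i) X) = B X X) ->
  forall X, H X -> B (I X) (I X) = B X X.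
Proof.
move=> Bl Br BI X HX.
have BDl Z U V : B (U + V) Z = B U Z + B V Z.
  by have := Bl Z 1 U V; rewrite !scale1r.
have BDr Z U V : B Z (U + V) = B Z U + B Z V.
  by have := Br Z 1 U V; rewrite !scale1r.
have B0l Z : B 0 Z = 0 by apply: (addrI (B 0 Z)); rewrite -BDl !addr0.
have B0r Z : B Z 0 = 0 by apply: (addrI (B Z 0)); rewrite -BDr !addr0.
have BZl b Z U : B (b *: U) Z = b *: B U Z.
  by have := Bl Z b U 0; rewrite B0l !addr0.
have BZr b Z U : B Z (b *: U) = b *: B Z U.
  by have := Br Z b U 0; rewrite B0r !addr0.
have BNl Z U : B (- U) Z = - B U Z by rewrite -scaleN1r BZl scaleN1r.
have BNr Z U : B Z (- U) = - B Z U by rewrite -scaleN1r BZr scaleN1r.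
pose P U V := B U V + B V U.
have P0 i Y : H Y -> P Y (phi (S i) Y) = 0.
  move=> HY; have HpY := horizontal_phi i HY.
  (* Since [phi_i (Y + phi_i Y) = phi_i Y - Y], invariance at [Y + phi_i Y] says that P(Y, phi_i Y)
     equals its own negative. *)
  have := BI i _ (horizontalD HY HpY).
  rewrite linearD /= phi_phi // !(BDl, BDr) !(BNl, BNr) opprK BI // => E.
  apply: (half_eq0v halfE); apply/eqP; rewrite eq_sym; apply/eqP.
  by apply: (eq_of_sub E); rewrite /P; apply: (metric_inj (g := g)) => Z; rewrite !gE; ring.
have P1 i j : i != j -> P (phi (S i) X) (phi (S j) X) = 0.
  (* Up to sign [phi_j X] is [phi_k Y] with [Y = phi_i X], so [P0] applies at [Y]. *)
  move=> ij; have [k [[_ _ e]|[_ e _]]] := even_permutation_of_neq ij.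
    by rewrite -(phi_cyc e HX).1; apply: P0; exact: horizontal_phi.
  have -> : phi (S j) X = - phi (S k) (phi (S i) X) by rewrite (phi_cyc e HX).2 opprK.
  by rewrite /P BNl BNr -opprD -/(P _ _) P0 ?oppr0 //; exact: horizontal_phi.
apply: (metric_inj (g := g)) => Z.
have swap i j : i != j ->
  g (B (phi (S j) X) (phi (S i) X)) Z = - g (B (phi (S i) X) (phi (S j) X)) Z.
  move=> /P1 ij; apply/eqP; rewrite -addr_eq0 addrC -gE; apply/eqP.
  by rewrite -/(P _ _) ij gE.
rewrite comb_phiE !(BDl, BDr) !(BZl, BZr) !BI // !gE.
rewrite (swap 0 1) // (swap 0 2) // (swap 1 2) //.
(* The mixed terms have cancelled in pairs; the diagonal ones carry the squares of the coordinates
   of [a], whose sum is 1. *)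
by apply: (eq_of_sub (congr1 ( *%R^~ (g (B X X) Z)) sphere_sqr)); ring.
Qed.

(** The mixed products cancel by anticommutation, and the squares add up to minus the squared norm
    of [a]. *)
Lemma comb_phi_comb_phi X : H X -> I (I X) = - X.
Proof.
move=> HX; rewrite !comb_phiE !(linearD, linearZ) /= !phi_phi //.
rewrite (@phi_anticomm 1 0) // (@phi_anticomm 2 0) // (@phi_anticomm 2 1) //.
apply: (metric_inj (g := g)) => Z; rewrite !gE.
by apply: (eq_of_sub (congr1 ( *%R^~ (- g X Z)) sphere_sqr)); ring.
Qed.

End Sphere.
End ThreeContact.

(** * Differences of metric connections with skew torsion *)

Section DifferenceTensor.
Variables (R : realType) (m : nat) (M : smooth_manifold R m) (g : riem_metric M).
Variables (D E : connection M).
Hypotheses (Dm : metric_connection g D) (Em : metric_connection g E)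
           (Ds : skew_torsion g D) (Es : skew_torsion g E).
Let gC := Defs.metric_sym g.
Let gE := sformE gC (metric_lin g).
Local Notation halfE := (scst_half M).

(* Locked so that rewriting with [sformDl] and its kin does not see through it. *)
Definition diff X Y := locked (E X Y - D X Y).

Lemma diffE X Y : diff X Y = E X Y - D X Y.
Proof. by rewrite /diff -lock. Qed.

Lemma diff_linearl Y : linear (diff^~ Y).
Proof.
by move=> f X Z; rewrite !diffE !(nabla_lin _ Y f) scalerBr opprD addrACA.
Qed.

Lemma diff_linearr X : linear (diff X).
Proof.
move=> f Y Z; rewrite !diffE !nabla_add !nabla_leibniz.
apply: (metric_inj (g := g)) => W; rewrite !gE; ring.
Qed.

Lemma diff_skew X Y Z : g (diff X Y) Z = - g Y (diff X Z).
Proof.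
have := Dm X Y Z; rewrite Em => e.
by rewrite !diffE !gE; apply: (eq_of_sub e); ring.
Qed.

Lemma diffNr X Y : diff X (- Y) = - diff X Y.
Proof. by rewrite !diffE !nablaNr opprB opprK addrC. Qed.

Lemma diff_torsion X Y : diff X Y = diff Y X + torsion E X Y - torsion D X Y.
Proof.
by apply: (metric_inj (g := g)) => Z; rewrite !diffE /torsion !gE; ring.
Qed.

(** Together with [diff_skew] this makes [diff] a 3-form. Metric skewness turns g(diff X X, Z) into
    -g(diff X Z, X); exchanging [X] and [Z] costs torsion terms with a repeated argument, which
    vanish, and g(diff Z X, X) is zero by skewness. *)
Lemma diff_diag X : diff X X = 0.
Proof.
apply: (metric_nondeg (g := g)) => Z.
have XX : g (diff Z X) X = 0.
  by apply: (half_eq0 halfE); rewrite {1}diff_skew (gC X) addNr.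
have [_ _ _ /(_ X Z)[_ tE _]] := Es; have [_ _ _ /(_ X Z)[_ tD _]] := Ds.
rewrite diff_skew (gC X) diff_torsion.
by rewrite (sformBl (metric_lin g)) (sformDl (metric_lin g)) XX tE tD; ring.
Qed.

Lemma diff_anti X Y : diff X Y = - diff Y X.
Proof.
have := diff_diag (X + Y).
have addl U V W : diff (U + V) W = diff U W + diff V W.
  by have := diff_linearl W 1 U V; rewrite !scale1r.
have addr U V W : diff W (U + V) = diff W U + diff W V.
  by have := diff_linearr W 1 U V; rewrite !scale1r.
rewrite addl !addr !diff_diag add0r addr0 => /eqP.
by rewrite addr_eq0 => /eqP.
Qed.

Lemma diff_cyc X Y Z : g (diff X Y) Z = g (diff Z X) Y.
Proof. by rewrite diff_skew diff_anti gE opprK gC. Qed.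

Variables (H : set (vfield M)) (A : contact_tensors M).
Hypotheses (HN : forall X, H X -> H (- X)) (HB : forall X Y, H X -> H Y -> H (X - Y)).
Hypotheses (DH : forall X Y, H Y -> H (D X Y)) (EH : forall X Y, H Y -> H (E X Y)).
Hypotheses (Hphi : forall X, H X -> H (phi A X))
           (phi2 : forall X, H X -> phi A (phi A X) = - X)
           (gphi : forall X Y, H X -> H Y -> g (phi A X) Y = - g X (phi A Y)).

Lemma diff_closed X Y : H Y -> H (diff X Y).
Proof. by move=> HY; rewrite diffE; apply: HB; [exact: EH|exact: DH]. Qed.

(** Where [E] makes [phi] parallel this is the covariant derivative of [phi] under [D]; written as a
    commutator, it exposes the symmetries of the 3-form [diff]. *)
Definition comm_diff X Y := phi A (diff X Y) - diff X (phi A Y).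

(** The transpose of [comm_diff], explicit because cyclic symmetry of [diff] moves the first
    argument of [comm_diff] into the last slot. *)
Definition comm_diff_tr U V := - diff (phi A U) V - diff U (phi A V).

Lemma comm_diff_linearl Y : linear (comm_diff^~ Y).
Proof.
move=> f X Z; rewrite /comm_diff !(diff_linearl _ f) linearP.
by apply: (metric_inj (g := g)) => W; rewrite !gE; ring.
Qed.

Lemma comm_diff_linearr X : linear (comm_diff X).
Proof.
move=> f Y Z; rewrite /comm_diff diff_linearr !linearP diff_linearr.
by apply: (metric_inj (g := g)) => W; rewrite !gE; ring.
Qed.

Lemma comm_diff_closed X Y : H Y -> H (comm_diff X Y).
Proof.
by move=> HY; apply: HB; [apply: Hphi; exact: diff_closed|apply: diff_closed; exact: Hphi].
Qed.

Lemma comm_diff_tr_closed X Y : H Y -> H (comm_diff_tr X Y).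
Proof.
move=> HY; apply: HB; first by apply: HN; exact: diff_closed.
by apply: diff_closed; exact: Hphi.
Qed.

Lemma comm_diff_skew X Y Z : H Y -> H Z ->
  g (comm_diff X Y) Z = - g Y (comm_diff X Z).
Proof.
move=> HY HZ; rewrite /comm_diff !gE gphi //; last exact: diff_closed.
rewrite (gC Y (phi A _)) (gphi _ HY); last exact: diff_closed.
by rewrite (diff_skew X (phi A Y)) (diff_skew X Y) (gC (phi A Y)); ring.
Qed.

(** Both sides reduce to [- diff X (phi A X)], since [diff] is alternating and [phi] squares to -1
    on H. *)
Lemma comm_diff_diag X : H X ->
  comm_diff (phi A X) (phi A X) = comm_diff X X.
Proof.
move=> HX; rewrite /comm_diff !diff_diag linear0 !sub0r phi2 //.
rewrite (diff_anti X) opprK.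
by rewrite diffNr opprK.
Qed.

Lemma form_comm_diff_tr X Y Z : H X -> H Y ->
  g (comm_diff_tr X Y) Z = g (comm_diff Z X) Y.
Proof.
move=> HX HY; rewrite /comm_diff_tr /comm_diff !gE.
rewrite gphi //; last exact: diff_closed.
by rewrite (diff_cyc _ Y) (diff_cyc X (phi A Y)); ring.
Qed.

Lemma nabla_phi_comm_diff X Y : nabla_phi E A X Y = 0 ->
  nabla_phi D A X Y = comm_diff X Y.
Proof.
rewrite /nabla_phi /comm_diff !diffE => /eqP; rewrite subr_eq0 => /eqP ->.
by rewrite linearB /= opprB [RHS]addrC addrA addrNK.
Qed.

End DifferenceTensor.

(** * The compatible connection of a point of the sphere *)

Section CompatibleSphere.
Variables (R : realType) (m : nat) (M : smooth_manifold R m) (g : riem_metric M).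
Variables (S : almost_3contact_metric g) (D : 'I_3 -> connection M).
Hypothesis Dc : forall i, compatible S (S i) (D i).
Variable a : 'I_3 -> R.
Hypothesis a_sphere : \sum_i a i ^+ 2 = 1.
Local Notation H := (horizontal S).
Local Notation h := (horizontal_proj S).
Local Notation I := (comb_phi a (fun i => S i)).
Local Notation c i := (scst M (a i)).
Let gC := Defs.metric_sym g.
Let gE := sformE gC (metric_lin g).
Local Notation halfE := (scst_half M).

Let Dm i : metric_connection g (D i). Proof. by case: (Dc i). Qed.
Let Ds i : skew_torsion g (D i). Proof. by case: (Dc i). Qed.
Let DH i X Y : H Y -> H (D i X Y). Proof. by case: (Dc i) => _ _ [DH _] _; exact: DH. Qed.
Let Dphi i X Y : H X -> H Y -> nabla_phi (D i) (S i) X Y = 0.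
Proof. by case: (Dc i) => _ _ _; exact. Qed.

Local Notation comm i := (comm_diff (D 0) (D i) (S i)).
Local Notation tr i := (comm_diff_tr (D 0) (D i) (S i)).

(** Refers all three tensors to the single connection [D 0], so that they can be compared. *)
Lemma comm_nabla i X Y : H X -> H Y -> comm i X Y = nabla_phi (D 0) (S i) X Y.
Proof. by move=> HX HY; rewrite -nabla_phi_comm_diff //; exact: Dphi. Qed.

Lemma comm_closed i X Y : H Y -> H (comm i X Y).
Proof.
move=> HY; apply: comm_diff_closed HY => [U W|U W|U W|U];
  by [exact: horizontalB|exact: DH|exact: horizontal_phi].
Qed.

Lemma comm0 X Y : H X -> H Y -> comm 0 X Y = 0.
Proof. by move=> HX HY; rewrite comm_nabla // Dphi. Qed.

(** On H one has [phi_2 = phi_0 phi_1], and [D 0] differentiates [phi_0] to zero there. *)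
Lemma comm2 X Y : H X -> H Y -> comm 2 X Y = phi (S 0) (comm 1 X Y).
Proof.
move=> HX HY; have HpY := horizontal_phi (S := S) 1 HY.
rewrite !comm_nabla // /nabla_phi -!(phi_cyc even_permutation_012 _).1 //; last exact: DH.
have := Dphi 0 HX HpY; rewrite /nabla_phi => /eqP; rewrite subr_eq0 => /eqP ->.
by rewrite linearB.
Qed.

Lemma comm1_diag i X : H X -> comm 1 (phi (S i) X) (phi (S i) X) = comm 1 X X.
Proof.
have comm_diag j Y : H Y -> comm j (phi (S j) Y) (phi (S j) Y) = comm j Y Y.
  move=> HY; apply: (@comm_diff_diag _ _ _ g _ _ (Dm 0) (Dm j) (Ds 0) (Ds j) H) => //.
  by move=> Z HZ; rewrite phi_phi.
(* The invariance of [comm 2] under [phi_2] passes to [comm 1], because [phi_0] is injective on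
   H. *)
have diag2 Y : H Y -> comm 1 (phi (S 2) Y) (phi (S 2) Y) = comm 1 Y Y.
  move=> HY; have H2 := horizontal_phi (S := S) 2 HY.
  have := congr1 (phi (S 0)) (comm_diag 2 Y HY).
  by rewrite !comm2 // !phi_phi; try exact: comm_closed; move/oppr_inj.
move=> HX; case: (ord3_cases i) => ->; [|exact: comm_diag|exact: diag2].
have H2 := horizontal_phi (S := S) 2 HX.
(* The remaining case [phi_0] is the composite [phi_1 phi_2] on H. *)
by rewrite -!(phi_cyc even_permutation_120 HX).1 comm_diag // diag2.
Qed.

Definition comb_comm X Y := \sum_i c i *: comm i X Y.
Definition comb_tr X Y := \sum_i c i *: tr i X Y.

Lemma comb_comm_nabla X Y : H X -> H Y ->
  comb_comm X Y = D 0 X (I Y) - I (D 0 X Y).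
Proof.
move=> HX HY; rewrite /comb_comm /comb_phi nabla_sumr -sumrB.
by apply: eq_bigr => i _; rewrite nabla_scst -scalerBr comm_nabla.
Qed.

(** As [comm 0] vanishes and [comm 2] is [phi_0] of [comm 1], the diagonal of the combination is
    determined by that of [comm 1], to which [diag_comb_phi] applies. *)
Lemma comb_comm_diag X : H X -> comb_comm (I X) (I X) = comb_comm X X.
Proof.
have E Y : H Y -> comb_comm Y Y = c 1 *: comm 1 Y Y + c 2 *: phi (S 0) (comm 1 Y Y).
  move=> HY; rewrite /comb_comm !big_ord_recl big_ord0 addr0.
  rewrite comm0 // scaler0 add0r -comm2 //.
  have -> : lift ord0 ord0 = 1 :> 'I_3 by exact: val_inj.
  by have -> : lift ord0 (lift ord0 ord0) = 2 :> 'I_3 by exact: val_inj.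
move=> HX; rewrite !E //; last exact: horizontal_comb_phi.
rewrite (diag_comb_phi a_sphere _ _ comm1_diag HX) // => Z.
  exact: (comm_diff_linearl g).
exact: (comm_diff_linearr g).
Qed.

Lemma comb_comm_linearl Y : linear (comb_comm^~ Y).
Proof.
move=> f X Z; rewrite /comb_comm scaler_sumr -big_split; apply: eq_bigr => i _.
by rewrite (comm_diff_linearl g) scalerDr !scalerA mulrC.
Qed.

Lemma comb_comm_linearr X : linear (comb_comm X).
Proof.
move=> f Y Z; rewrite /comb_comm scaler_sumr -big_split; apply: eq_bigr => i _.
by rewrite (comm_diff_linearr g) scalerDr !scalerA mulrC.
Qed.

Lemma comb_comm_closed X Y : H Y -> H (comb_comm X Y).
Proof.
by move=> HY; apply: horizontal_sum => i; apply: horizontalZ; exact: comm_closed.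
Qed.

Lemma comb_tr_closed X Y : H Y -> H (comb_tr X Y).
Proof.
move=> HY; apply: horizontal_sum => i; apply: horizontalZ.
apply: comm_diff_tr_closed HY => [U|U W|U W|U W|U];
  by [exact: horizontalN|exact: horizontalB|exact: DH|exact: horizontal_phi].
Qed.

(** This is the derivative along [D 0] of [I (I Y) = - Y] on H. *)
Lemma comb_comm_anticomm X Y : H X -> H Y -> comb_comm X (I Y) = - I (comb_comm X Y).
Proof.
move=> HX HY; have HIY := horizontal_comb_phi (S := S) a HY.
have HDY : H (D 0 X Y) by exact: DH.
rewrite !comb_comm_nabla // comb_phi_comb_phi // nablaNr.
have -> U V : I (U - V) = I U - I V by exact: linearB.
by rewrite comb_phi_comb_phi // opprB addrC.
Qed.

Lemma comb_comm_skew X Y Z : H Y -> H Z ->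
  g (comb_comm X Y) Z = - g Y (comb_comm X Z).
Proof.
move=> HY HZ; rewrite (sform_suml (metric_lin g)) (sform_sumr gC (metric_lin g)).
rewrite -sumrN; apply: eq_bigr => i _.
rewrite (sformZl (metric_lin g)) (sformZr gC (metric_lin g)) -mulrN; congr (_ * _).
apply: (@comm_diff_skew _ _ _ g _ _ (Dm 0) (Dm i) H) => //.
- exact: horizontalB.
- exact: DH.
- exact: DH.
- by move=> U W HU HW; rewrite metric_phi.
Qed.

Lemma form_comb_tr X Y Z : H X -> H Y ->
  g (comb_tr X Y) Z = g (comb_comm Z X) Y.
Proof.
move=> HX HY; rewrite !(sform_suml (metric_lin g)); apply: eq_bigr => i _.
rewrite !(sformZl (metric_lin g)); congr (_ * _).
apply: (@form_comm_diff_tr _ _ _ g _ _ (Dm 0) (Dm i) (Ds 0) (Ds i) H) => //.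
- exact: horizontalB.
- exact: DH.
- exact: DH.
- by move=> U W HU HW; rewrite metric_phi.
Qed.

(** * The correcting 3-form and the corrected connection *)

Let HI := horizontal_comb_phi (S := S) a.
Let II := comb_phi_comb_phi (S := S) a_sphere.
Let gI := metric_comb_phi (S := S) a.
Let HB X Y (_ : H X) (HY : H Y) := comb_comm_closed X HY.
Let Hb X Y (_ : H X) (HY : H Y) := comb_tr_closed X HY.
Let gB X Y Z (_ : H X) (HY : H Y) (HZ : H Z) := comb_comm_skew X HY HZ.
Let gb X Y Z (HX : H X) (HY : H Y) (_ : H Z) := form_comb_tr Z HX HY.
Let g_scalar := metric_lin g.
Let h_horizontal X : H (h X) := horizontal_horizontal_proj S X.
Let H_linear := horizontal_linear (S := S).
Let I_linear : linear I := @comb_phi_linear _ _ _ a (fun i => S i).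

(** The projections extend the correction by zero on V; since its values lie in H, the associated
    3-form is purely horizontal. *)
Definition sphere_form (X Y : vfield M) : vfield M :=
  skew_correction (scst M 2^-1) I comb_comm comb_tr (h X) (h Y).

Lemma sphere_form_horizontal X Y : H (sphere_form X Y).
Proof. exact: (H_skew_correction _ H_linear HI HB Hb). Qed.

Lemma metric_sphere_form X Y Z : g (sphere_form X Y) Z = g (sphere_form X Y) (h Z).
Proof. by rewrite -horizontal_proj_sym horizontal_projE //; exact: sphere_form_horizontal. Qed.

Lemma sphere_form_linearl Y : linear (sphere_form^~ Y).
Proof.
move=> f X U; apply: (metric_inj (g := g)) => Z.
rewrite metric_sphere_form (sformDl g_scalar) (sformZl g_scalar f).
rewrite !(metric_sphere_form _ _ Z) /sphere_form horizontal_proj_linear.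
exact: (skew_correction_linearl gC g_scalar _ H_linear I_linear HI gI
  comb_comm_linearl comb_comm_linearr HB gB gb _
  (h_horizontal _) (h_horizontal _) (h_horizontal _) (h_horizontal _)).
Qed.

Lemma sphere_form_linearr X : linear (sphere_form X).
Proof.
move=> f Y U; apply: (metric_inj (g := g)) => Z.
rewrite metric_sphere_form (sformDl g_scalar) (sformZl g_scalar f).
rewrite !(metric_sphere_form _ _ Z) /sphere_form horizontal_proj_linear.
exact: (skew_correction_linearr gC g_scalar _ H_linear HI gI
  comb_comm_linearl comb_comm_linearr HB gB gb _
  (h_horizontal _) (h_horizontal _) (h_horizontal _) (h_horizontal _)).
Qed.

Lemma sphere_form_diag X : sphere_form X X = 0.
Proof.
apply: (metric_nondeg (g := g)) => Z; rewrite metric_sphere_form.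
exact: (skew_correction_alt12 gC g_scalar halfE HI II gI HB
  comb_comm_anticomm gB comb_comm_diag gb (h_horizontal _) (h_horizontal _)).
Qed.

Lemma metric_sphere_form_diag X Y : g (sphere_form X Y) Y = 0.
Proof.
rewrite metric_sphere_form.
exact: (skew_correction_alt23 gC g_scalar halfE HI gI HB comb_comm_anticomm gB gb
  (h_horizontal _) (h_horizontal _)).
Qed.

Lemma sphere_formDr X : {morph sphere_form X : Y Z / Y + Z}.
Proof. by move=> Y Z; have := sphere_form_linearr X 1 Y Z; rewrite !scale1r. Qed.

Lemma sphere_formDl Z : {morph sphere_form^~ Z : X Y / X + Y}.
Proof. by move=> X Y; have := sphere_form_linearl Z 1 X Y; rewrite !scale1r. Qed.

Lemma sphere_formZr X f Y : sphere_form X (f *: Y) = f *: sphere_form X Y.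
Proof.
have t0 : sphere_form X 0 = 0.
  by apply: (addrI (sphere_form X 0)); rewrite -sphere_formDr !addr0.
by have := sphere_form_linearr X f Y 0; rewrite t0 !addr0.
Qed.

Lemma sphere_form_anti X Y : sphere_form Y X = - sphere_form X Y.
Proof.
have := sphere_form_diag (X + Y).
rewrite sphere_formDl !sphere_formDr !sphere_form_diag add0r addr0 addrC => /eqP.
by rewrite addr_eq0 => /eqP.
Qed.

Lemma metric_sphere_form_skew X Y Z :
  g (sphere_form X Y) Z = - g (sphere_form X Z) Y.
Proof.
have := metric_sphere_form_diag X (Y + Z).
rewrite sphere_formDr !(sformDl g_scalar) !(sformDr gC g_scalar).
rewrite !metric_sphere_form_diag add0r addr0 => /eqP.
by rewrite addr_eq0 => /eqP.
Qed.

Definition sphere_nabla X Y := D 0 X Y + sphere_form X Y.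

Lemma sphere_nabla_linear Y : linear (sphere_nabla^~ Y).
Proof.
move=> f X Z; rewrite /sphere_nabla nabla_lin (sphere_form_linearl Y f).
by rewrite scalerDr addrACA.
Qed.

Lemma sphere_nabla_add X : {morph sphere_nabla X : Y Z / Y + Z}.
Proof. by move=> Y Z; rewrite /sphere_nabla nabla_add sphere_formDr addrACA. Qed.

Lemma sphere_nabla_leibniz X (f : sfun M) Y :
  sphere_nabla X (f *: Y) = X f *: Y + f *: sphere_nabla X Y.
Proof.
by rewrite /sphere_nabla nabla_leibniz sphere_formZr scalerDr addrA.
Qed.

Definition sphere_connection : connection M :=
  Connection sphere_nabla_linear sphere_nabla_add sphere_nabla_leibniz.

Lemma sphere_connection_metric : metric_connection g sphere_connection.
Proof.
move=> X Y Z; rewrite (Dm 0) /= /sphere_nabla (sformDl g_scalar) (sformDr gC g_scalar).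
rewrite (metric_sphere_form_skew X Y) (gC Y (sphere_form _ _)); ring.
Qed.

Lemma sphere_connection_torsion X Y :
  torsion sphere_connection X Y = torsion (D 0) X Y + (sphere_form X Y + sphere_form X Y).
Proof.
rewrite /torsion /= /sphere_nabla (sphere_form_anti X Y).
apply: (metric_inj (g := g)) => Z; rewrite !gE; ring.
Qed.

Lemma sphere_connection_skew : skew_torsion g sphere_connection.
Proof.
have [T1 T2 T3 T4] := Ds 0.
have tE X Y Z : g (torsion sphere_connection X Y) Z =
    g (torsion (D 0) X Y) Z + (g (sphere_form X Y) Z + g (sphere_form X Y) Z).
  by rewrite sphere_connection_torsion !(sformDl g_scalar).
split.
- move=> Y Z f X U; rewrite !tE T1 sphere_form_linearl.
  by rewrite (sformDl g_scalar (f *: _)) (sformZl g_scalar f); ring.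
- move=> X Z f Y U; rewrite !tE T2 sphere_form_linearr.
  by rewrite (sformDl g_scalar (f *: _)) (sformZl g_scalar f); ring.
- by move=> X Y f Z U; rewrite (sformDr gC g_scalar) (sformZr gC g_scalar f).
- move=> X Y; have [t1 t2 t3] := T4 X Y; rewrite !tE t1 t2 t3.
  rewrite sphere_form_diag metric_sphere_form_diag metric_sphere_form_skew.
  by rewrite sphere_form_diag (sform0l g_scalar) oppr0 !addr0.
Qed.

Lemma sphere_connection_splitting : preserves_splitting S sphere_connection.
Proof.
have [_ _ [_ DV] _] := Dc 0; split=> X Y HY.
  by apply: horizontalD; [exact: DH|exact: sphere_form_horizontal].
(* For vertical [Y], skewness moves [Y] into the last slot, where its horizontal projection
   vanishes. *)
suff -> : sphere_connection X Y = D 0 X Y by exact: DV.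
rewrite /= /sphere_nabla; apply: (metric_inj (g := g)) => Z.
rewrite (sformDl g_scalar) metric_sphere_form_skew metric_sphere_form.
by rewrite horizontal_proj_vertical // (sform0r gC g_scalar) oppr0 addr0.
Qed.

Lemma sphere_connection_compatible :
  compatible S (comb_tensors a (fun i => S i)) sphere_connection.
Proof.
split; [exact: sphere_connection_metric|exact: sphere_connection_skew
       |exact: sphere_connection_splitting|move=> X Y HX HY].
have HIY := HI HY.
have tEl U W : H U -> H W -> sphere_form U W =
    skew_correction (scst M 2^-1) I comb_comm comb_tr U W.
  by move=> HU HW; rewrite /sphere_form !horizontal_projE.
have HP : H (nabla_phi sphere_connection (comb_tensors a (fun i => S i)) X Y).
  have HDs U W : H W -> H (sphere_connection U W).
    by move=> HW; apply: horizontalD; [exact: DH|exact: sphere_form_horizontal].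
  by apply: horizontalB; [exact: HDs|apply: HI; exact: HDs].
apply: (metric_nondeg (g := g)) => Z.
(* The derivative lies in H, so testing it against [h Z] suffices and the horizontal identity
   [skew_correction_parallel] applies. *)
rewrite -(horizontal_projE HP) horizontal_proj_sym.
rewrite -[RHS](skew_correction_parallel gC g_scalar halfE H_linear I_linear HI II gI
  comb_comm_linearl comb_comm_linearr HB comb_comm_anticomm gB Hb comb_comm_diag gb
  HX HY (h_horizontal Z)).
rewrite -!tEl // comb_comm_nabla // /nabla_phi /= /sphere_nabla.
have -> U V : I (U + V) = I U + I V by exact: linearD.
by congr (g _ _); rewrite opprD addrACA addrA.
Qed.

End CompatibleSphere.

Theorem corollary3p1p1 (R : realType) (n : nat)
    (M : smooth_manifold R (4 * n + 3)%N) (g : riem_metric M)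
    (S : almost_3contact_metric g) :
  (forall i : 'I_3, exists D : connection M, compatible S (S i) D) ->
  forall A : contact_tensors M, associated_sphere S A ->
    exists D : connection M, compatible S A D.
Proof.
move=> /choice[D Dc] A [a a_sphere <-].
by exists (sphere_connection Dc a); exact: sphere_connection_compatible.
Qed.
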